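(* Let $G = (\Gamma, B)$ be a lattice game played on a polyhedral set $\Lambda = \Pi \cap \mathbb{Z}^d$. If the misère quotient $\Lambda/\!\sim$ is finite, then $G$ admits an affine stratification, i.e. its set $\mathcal{P}$ of $P$-positions possesses an affine stratification.
   Context: Setting: $\Pi \subseteq \mathbb{R}^d$ is a pointed rational convex polyhedron, $\Pi = P + C$ with $P$ a polytope and recession cone $C$ of dimension $d$; $\Lambda = \Pi \cap \mathbb{Z}^d$. A rule set is a finite set $\Gamma \subset \mathbb{Z}^d \setminus \{0\}$ such that (i) some linear function on $\mathbb{R}^d$ is positive on $\Gamma \cup C \setminus \{0\}$, and (ii) there is a finite set $F \subset \Lambda$ such that every $p \in \Lambda$ has a sequence $p = p_r, \ldots, p_0 \in \Lambda$ with $p_0 \in F$ and $p_k - p_{k-1} \in \Gamma$ for all $k$. The rule set induces a partial order on $\Lambda$: $p \preceq q$ iff $q - p \in \mathbb{N}\Gamma$. A game board $B$ is the complement in $\Lambda$ of a finite order ideal (a finite down-closed set) of defeated positions. A lattice game is $G = (\Gamma, B)$. Its $P$-positions form the (unique) subset $\mathcal{P} \subseteq B$ with $(\mathcal{P} + \Gamma) \cap B = B \setminus \mathcal{P}$. Positions $p, q$ are indistinguishable, $p \sim q$, if $(p + C) \cap \mathcal{P} = p - q + (q + C) \cap \mathcal{P}$, i.e. $p + r \in \mathcal{P} \iff q + r \in \mathcal{P}$ for all $r \in C \cap \mathbb{Z}^d$; the misère quotient is $\Lambda/\!\sim$. An affine semigroup is a finitely generated submonoid of $\mathbb{Z}^d$;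 an affine stratification of a set $\mathcal{W} \subseteq \mathbb{Z}^d$ is a partition into finitely many pairwise disjoint sets each of the form $F_i + A_i$ with $F_i \subseteq \mathbb{Z}^d$ finite and $A_i$ an affine semigroup. An affine stratification of $G$ means one of $\mathcal{P}$. *)

(* Defs.v *)
From mathcomp Require Import all_boot all_order all_algebra.
From mathcomp Require Import classical_sets cardinality reals.

Set Implicit Arguments.
Unset Strict Implicit.
Unset Printing Implicit Defensive.

Import Order.TTheory GRing.Theory Num.Theory.
Local Open Scope classical_set_scope.
Local Open Scope ring_scope.

(* Vectors of R^d and Z^d are columns: 'cV[R]_d and 'cV[int]_d. *)

Definition minkowski_sum (V : zmodType) (A B : set V) : set V :=
  [set x + y | x in A & y in B].

(* NN S, the submonoid generated by S *)
Definition monoid_span (V : zmodType) (S : set V) : set V :=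
  [set x | exists2 s : seq V, (forall y, y \in s -> S y) & x = \sum_(y <- s) y].

Section Polyhedra.
Variables (R : realType) (d : nat).
Implicit Types (Pi P C : set 'cV[R]_d) (V : {vspace 'cV[R]_d}).

Definition rational_polyhedron Pi :=
  exists (m : nat) (A : 'M[rat]_(m, d)) (b : 'cV[rat]_m),
    Pi = [set x | forall i, (map_mx ratr A *m x) i 0 <= ratr (b i 0)].

Definition pointed Pi :=
  ~ exists x v, v != 0 /\ forall t : R, Pi (x + t *: v).

Definition recession_cone Pi : set 'cV[R]_d :=
  [set v | forall x, Pi x -> forall t : R, 0 <= t -> Pi (x + t *: v)].

Definition polytope P :=
  exists (n : nat) (v : 'I_n -> 'cV[R]_d),
    P = [set x | exists w : 'I_n -> R,
           [/\ forall i, 0 <= w i, \sum_i w i = 1 & x = \sum_i w i *: v i]].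

(* A cone contains 0, so its dimension is that of its linear span,
   the least subspace containing it. *)
Definition cone_dim C (n : nat) :=
  exists V, [/\ (forall x, C x -> x \in V),
                (forall U : {vspace 'cV[R]_d},
                   (forall x, C x -> x \in U) -> (V <= U)%VS)
              & (\dim V = n)%N].

Definition embed (p : 'cV[int]_d) : 'cV[R]_d := map_mx intr p.

Definition lattice_points (X : set 'cV[R]_d) : set 'cV[int]_d :=
  [set p | X (embed p)].

End Polyhedra.

Section Games.
Variables (R : realType) (d : nat) (Pi : set 'cV[R]_d).
Implicit Types (Gamma B D W : set 'cV[int]_d) (p q : 'cV[int]_d).

Local Notation C := (recession_cone Pi).
Local Notation Lambda := (lattice_points Pi).

Definition positive_functional Gamma :=
  exists l : {linear 'cV[R]_d -> R^o},
    forall v, (@embed R d @` Gamma `|` C) v -> v != 0 -> 0 < l v.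

(* For p the sequence is s r, ..., s 0; the values of s beyond r are
   irrelevant. *)
Definition reaches_finite_set Gamma :=
  exists F : set 'cV[int]_d, [/\ finite_set F, F `<=` Lambda &
    forall p, Lambda p ->
      exists (r : nat) (s : nat -> 'cV[int]_d),
        [/\ s r = p, F (s 0%N),
            (forall k, (k <= r)%N -> Lambda (s k)) &
            (forall k, (k < r)%N -> Gamma (s k.+1 - s k))]].

Definition rule_set Gamma :=
  [/\ finite_set Gamma, ~ Gamma 0,
      positive_functional Gamma & reaches_finite_set Gamma].

Definition rule_le Gamma p q := monoid_span Gamma (q - p).

Definition order_ideal Gamma D :=
  D `<=` Lambda /\
  forall p q, Lambda p -> D q -> rule_le Gamma p q -> D p.

Definition game_board Gamma B :=
  exists D, [/\ finite_set D, order_ideal Gamma D & B = Lambda `\` D].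

Definition lattice_game Gamma B := rule_set Gamma /\ game_board Gamma B.

(* W is the set of P-positions of the game (Gamma, B) *)
Definition P_positions Gamma B W :=
  W `<=` B /\ minkowski_sum W Gamma `&` B = B `\` W.

Definition indistinguishable W p q :=
  minkowski_sum [set p] (lattice_points C) `&` W =
  minkowski_sum [set p - q]
    (minkowski_sum [set q] (lattice_points C) `&` W).

(* The quotient of Lambda, as its set of equivalence classes *)
Definition misere_quotient W : set (set 'cV[int]_d) :=
  [set [set q | Lambda q /\ indistinguishable W p q] | p in Lambda].

End Games.

Definition affine_semigroup (d : nat) (A : set 'cV[int]_d) :=
  exists2 S : set 'cV[int]_d, finite_set S & A = monoid_span S.

Definition affine_stratification (d n : nat) (W : set 'cV[int]_d)
    (F A : 'I_n -> set 'cV[int]_d) :=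
  [/\ forall i, finite_set (F i), forall i, affine_semigroup (A i) &
      partition [set: 'I_n] (fun i => minkowski_sum (F i) (A i)) W].

Definition has_affine_stratification (d : nat) (W : set 'cV[int]_d) :=
  exists (n : nat) (F A : 'I_n -> set 'cV[int]_d), affine_stratification W F A.

(* Main.v *)
Require Import Defs.
From mathcomp Require Import all_boot all_order all_algebra.
From mathcomp Require Import classical_sets cardinality reals.
From mathcomp Require Import boolp zify.

(** The integer points of Pi are G + N a_1 + ... + N a_k with G finite and the
    a_i in C.  Among the pairs (g, u) in G x N^k representing a point, keep the
    lexicographically least; for fixed g the least representatives form a
    down-closed subset of N^k, so by Dickson's lemma membership is unchanged by
    incrementing a coordinate that is already large.  By the pigeonhole
    principle in the finite quotient, the P-positions along p, p + a_i,
    p + 2 a_i, ... are periodic from a bound on and with a period which do not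
    depend on p.  Hence the least representatives of P-positions split into
    finitely many boxes r + c N^{i : r_i >= t}, and these map injectively to
    disjoint translates of affine semigroups. *)

Set Implicit Arguments.
Unset Strict Implicit.
Unset Printing Implicit Defensive.

Import Order.TTheory GRing.Theory Num.Theory.
Local Open Scope classical_set_scope.

(** * Dickson's lemma and lexicographic minima *)

(** Induction on [fs]. A list [s] that works for the tail handles every [x] with [f x] at least the
    maximum [t] of [f] on [s]. Each of the finitely many values below [t] cuts out a slice of [S],
    to which the induction hypothesis applies again. *)
Lemma dickson (T : eqType) (fs : seq (T -> nat)) (S : set T) :
  exists s : seq T, (forall x, x \in s -> S x) /\
    forall x, S x -> exists2 y, y \in s & List.Forall (fun f => f y <= f x) fs.
Proof.
elim: fs S => [|f fs IH] S.
  have [[x Sx]|S0] := pselect (S !=set0).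
    by exists [:: x]; split=> [y|y _]; [rewrite inE => /eqP->|exists x; rewrite ?inE].
  by exists [::]; split=> // x Sx; case: S0; exists x.
have [s [sS sP]] := IH S.
pose t := \max_(y <- s) f y.
have [r [rS rP]] : exists r : seq T, (forall x, x \in r -> S x) /\
    forall x, S x -> f x < t -> exists2 y, y \in r &
      f y = f x /\ List.Forall (fun f => f y <= f x) fs.
  elim: (t) => [|n [r [rS rP]]]; first by exists [::].
  have [s1 [s1S s1P]] := IH (S `&` [set x | f x = n]).
  exists (r ++ s1); split=> [x|x Sx].
    by rewrite mem_cat => /orP[/rS|/s1S[]].
  rewrite ltnS leq_eqVlt => /orP[/eqP fx|fx].
    have [y ys yx] := s1P x (conj Sx fx).
    by exists y; rewrite ?mem_cat ?ys ?orbT // fx; have [] := s1S y ys.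
  by have [y yr yx] := rP x Sx fx; exists y; rewrite // mem_cat yr.
exists (s ++ r); split=> [x|x Sx]; first by rewrite mem_cat => /orP[/sS|/rS].
have [fx|fx] := ltnP (f x) t.
  have [y yr [fy yx]] := rP x Sx fx.
  by exists y; [rewrite mem_cat yr orbT|constructor; rewrite ?fy].
have [y ys yx] := sP x Sx.
exists y; first by rewrite mem_cat ys.
by constructor=> //; apply: leq_trans fx; rewrite /t; apply: leq_bigmax_seq.
Qed.

Fixpoint lexle (T : Type) (fs : seq (T -> nat)) (x y : T) :=
  if fs is f :: fs' then (f x < f y) || (f x == f y) && lexle fs' x y else true.

Lemma lexle_anti (T : Type) (fs : seq (T -> nat)) (x y : T) :
  lexle fs x y -> lexle fs y x -> List.Forall (fun f => f x = f y) fs.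
Proof.
elim: fs => //= f fs IH; case: ltngtP => //= fxy /IH h /h h'.
by constructor.
Qed.

(** Translation invariance of the lexicographic order; it is what makes [normal] down-closed. *)
Lemma lexle_shift (T : Type) (fs : seq (T -> nat)) (x y x' y' : T) :
    List.Forall (fun f => exists c, f x' = f x + c /\ f y' = f y + c) fs ->
  lexle fs x' y' = lexle fs x y.
Proof.
by elim=> //= f {}fs [c [-> ->]] _ ->; rewrite ltn_add2r eqn_add2r.
Qed.

Lemma lexle_min (T : Type) (fs : seq (T -> nat)) (S : set T) :
  S !=set0 -> exists2 x, S x & forall y, S y -> lexle fs x y.
Proof.
elim: fs S => [|f fs IH] S [x0 Sx0]; first by exists x0.
have ex : exists n, `[< exists2 x, S x & f x = n >].
  by exists (f x0); apply/asboolP; exists x0.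
case: (ex_minnP ex) => n /asboolP[x1 Sx1 fx1] nmin.
have [|x [Sx fx] xmin] := IH (S `&` [set x | f x = n]); first by exists x1.
exists x => // y Sy /=; rewrite fx.
have : n <= f y by apply: nmin; apply/asboolP; exists y.
by rewrite leq_eqVlt => /orP[/eqP fy|->//]; rewrite fy eqxx xmin ?orbT.
Qed.

(** * Boxes in N^I *)

Section Boxes.
Variables (I : finType) (t c : nat).
Implicit Types (u : {ffun I -> nat}) (r : {ffun I -> 'I_(t + c)}) (s : seq I).

(* The list s stands for its vector of multiplicities. *)
Definition shift u s : {ffun I -> nat} := [ffun i => u i + c * count_mem i s].

Definition corner r : {ffun I -> nat} := [ffun i => r i : nat].

Lemma shift_nil u : shift u [::] = u.
Proof. by apply/ffunP=> i; rewrite ffunE muln0 addn0. Qed.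

Lemma shift_cons u i s : shift u (i :: s) = shift (shift u s) [:: i].
Proof. by apply/ffunP=> j; rewrite !ffunE /=; lia. Qed.

Lemma shift_periodic (S : set {ffun I -> nat}) u s :
    (forall (v : {ffun I -> nat}) i, t <= v i -> S v <-> S (shift v [:: i])) ->
  all (fun i => t <= u i) s -> S u <-> S (shift u s).
Proof.
move=> per; elim: s => [|i s IH] /=; first by rewrite shift_nil.
case/andP=> ti /IH ->; rewrite shift_cons; apply: per.
by rewrite ffunE; apply: leq_trans ti (leq_addr _ _).
Qed.

Hypothesis c_gt0 : 0 < c.

(** Subtracting [c] from a coordinate that is at least [t + c] lowers the coordinate sum, so the
    process ends in the finite box. *)
Lemma shift_corner_exists u :
  exists r s, all (fun i => t <= r i) s /\ u = shift (corner r) s.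
Proof.
have [n] := ubnP (\sum_i u i); elim: n u => // n IH u un.
have [/existsP[i iP]|/existsPn noti] := boolP [exists i, t + c <= u i].
  pose v : {ffun I -> nat} := [ffun j => u j - c * (j == i)].
  have uv : u = shift v [:: i].
    by apply/ffunP=> j; rewrite !ffunE /= eq_sym; case: eqP => [<-|_] /=; lia.
  have [|r [s [rs vE]]] := IH v.
    suff: \sum_i v i < \sum_i u i by move=> /leq_trans; apply.
    rewrite [X in _ < X](bigD1 i) // [X in X < _](bigD1 i) //=.
    have -> : \sum_(j | j != i) v j = \sum_(j | j != i) u j.
      by apply: eq_bigr => j /negbTE ji; rewrite ffunE ji muln0 subn0.
    by rewrite ffunE eqxx; lia.
  exists r, (i :: s); split; last by rewrite shift_cons -vE.
  (* The direction [i] is allowed: if [r i < t], then [i] is not in [s] and [v i = r i < t], whereas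
     [v i = u i - c] is at least [t]. *)
  rewrite /= rs andbT leqNgt; apply/negP => rit.
  have : v i = shift (corner r) s i by rewrite vE.
  have /count_memPn si : i \notin s by apply/negP => /(allP rs); lia.
  by rewrite !ffunE si eqxx; lia.
have ub i : u i < t + c by rewrite ltnNge noti.
exists [ffun i => Ordinal (ub i)], [::]; split=> //.
by rewrite shift_nil; apply/ffunP=> i; rewrite !ffunE.
Qed.

Lemma shift_corner_inj r r' s s' :
    all (fun i => t <= r i) s -> all (fun i => t <= r' i) s' ->
  shift (corner r) s = shift (corner r') s' -> r = r'.
Proof.
(* The corner is read off coordinatewise: [digit n] is the reduction of n to [0, t + c). *)
pose digit n := if n < t then n else t + (n - t) %% c.
have digitE r0 s0 i : all (fun i => t <= r0 i) s0 ->
    digit (shift (corner r0) s0 i) = r0 i.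
  move=> rs; rewrite !ffunE /digit; have ri := ltn_ord (r0 i).
  have [rit|rit] := ltnP (r0 i) t.
    have /count_memPn -> : i \notin s0 by apply/negP => /(allP rs); lia.
    by rewrite muln0 addn0 rit.
  rewrite ltnNge (leq_trans rit (leq_addr _ _)) /=.
  by rewrite -addnBAC // (addnC (_ - _)) mulnC modnMDl modn_small ?subnKC // ltn_subLR.
move=> rs rs' E; apply/ffunP=> i; apply: val_inj => /=.
by rewrite -(digitE r s i rs) E digitE.
Qed.

End Boxes.

Lemma Forall_map_enum (I : finType) (T : Type) (F : I -> T) (P : T -> Prop) :
  List.Forall P [seq F i | i <- enum I] <-> forall i, P (F i).
Proof.
have H s : List.Forall P [seq F i | i <- s] <-> forall i, i \in s -> P (F i).
  elim: s => [|i s IH] /=; first by split=> // _; constructor.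
  split=> [/List.Forall_cons_iff[Pi /IH Ps] j|Ps].
    by rewrite inE => /orP[/eqP->//|/Ps].
  constructor; first by apply: Ps; rewrite inE eqxx.
  by apply/IH => j js; apply: Ps; rewrite inE js orbT.
by split=> [/H h i|h]; [apply: h; rewrite mem_enum|apply/H].
Qed.

(** * Normal forms *)

Section NormalForms.
Variables (V : zmodType) (J I : finType) (g : J -> V) (a : I -> V).
Local Notation point := (J * {ffun I -> nat})%type.
Implicit Types (z : point) (u v w : {ffun I -> nat}).

Definition value z : V := (g z.1 + \sum_i a i *+ z.2 i)%R.

(** The index is compared first, through its injective rank, so that [lexle coords] is a total order
    on points and least representatives are unique. *)
Definition coords : seq (point -> nat) :=
  (fun z => enum_rank z.1 : nat) :: [seq (fun z => z.2 i) | i <- enum I].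

Definition normal z := forall z', value z' = value z -> lexle coords z z'.

Lemma value_shift c j u s :
  value (j, shift c u s) = (value (j, u) + \sum_(i <- s) a i *+ c)%R.
Proof.
rewrite /value -addrA; congr (_ + _)%R.
elim: s => [|i s IH]; first by rewrite shift_nil big_nil addr0.
rewrite big_cons addrCA -IH shift_cons /=.
rewrite (bigD1 i) //= [in RHS](bigD1 i) //=.
rewrite ffunE /= eqxx addn0 muln1 mulrnDr [RHS]addrA [in RHS](addrC (a i *+ c)%R).
congr (_ + _)%R; apply: eq_bigr => k ki.
by rewrite ffunE /= eq_sym (negbTE ki) muln0 addn0.
Qed.

Lemma normal_unique z z' : normal z -> normal z' -> value z = value z' -> z = z'.
Proof.
move=> nz nz' zz'; have := lexle_anti (nz _ (esym zz')) (nz' _ zz').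
case/List.Forall_cons_iff => /val_inj /enum_rank_inj j12 /Forall_map_enum u12.
by case: z z' j12 u12 {nz nz' zz'} => [j u] [j' u'] /= -> E; congr pair; apply/ffunP.
Qed.

Lemma normal_exists z : exists2 z', normal z' & value z' = value z.
Proof.
have [|x xz xmin] := @lexle_min _ coords [set z' | value z' = value z].
  by exists z.
by exists x => // z' z'x; apply: xmin; rewrite /= z'x.
Qed.

(** A competitor [(j', u')] of [(j, u)], translated by [v - u], becomes a competitor of [(j, v)]
    with the same comparison. *)
Lemma normal_down j u v : (forall i, u i <= v i) -> normal (j, v) -> normal (j, u).
Proof.
move=> uv nv [j' u'] E; pose w : {ffun I -> nat} := [ffun i => u' i + (v i - u i)].
have addv : value (j', w) = value (j, v).
  rewrite /value /=.
  have -> : (\sum_i a i *+ w i =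
      \sum_i a i *+ u' i + \sum_i a i *+ (v i - u i)%N)%R.
    by rewrite -big_split; apply: eq_bigr => i _; rewrite ffunE mulrnDr.
  rewrite addrA [X in (X + _)%R]E /value /= -addrA -big_split /=; congr (_ + _)%R.
  by apply: eq_bigr => i _; rewrite -mulrnDr subnKC.
rewrite -(lexle_shift (x' := (j, v)) (y' := (j', w))); first exact: nv.
constructor; first by exists 0; rewrite !addn0.
by apply/Forall_map_enum => i; exists (v i - u i); rewrite /= ffunE subnKC.
Qed.

Lemma normal_stable c : exists t, forall j (u : {ffun I -> nat}) i, t <= u i ->
  normal (j, u) <-> normal (j, shift c u [:: i]).
Proof.
(* Bounding both the rank of j and its complement forces equality of the
   J-components in Dickson's order. *)
have [s [sN sP]] := dickson ((fun z => #|J| - enum_rank z.1) :: coords)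
  [set z | ~ normal z].
(* [t] bounds all coordinates of the finitely many non-normal points in [s]. Raising a coordinate
   that is already at least [t] therefore cannot make a point dominate a new one of them. *)
exists (\max_(z <- s) \max_i z.2 i) => j u i tu; split; last first.
  by apply: normal_down => k; rewrite ffunE leq_addr.
move=> nu; apply: contrapT => /sP[[j' v] vs].
case/List.Forall_cons_iff => /= j1 /List.Forall_cons_iff[/= j2 /Forall_map_enum /= le].
have jj : j' = j.
  have rank_inj (x y : J) : enum_rank x <= enum_rank y ->
      #|J| - enum_rank x <= #|J| - enum_rank y -> x = y.
    move=> xy yx; apply/enum_rank_inj/ord_inj.
    have ltx : enum_rank x < #|J| := ltn_ord _.
    have lty : enum_rank y < #|J| := ltn_ord _.
    apply/eqP; rewrite eqn_leq xy /=.
    by move: yx; rewrite leq_sub2lE // ltnW.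
  exact: rank_inj j2 j1.
apply: (sN _ vs); rewrite jj; apply: normal_down nu => k.
have := le k; rewrite !ffunE /=; case: eqP => [<- _|_]; last by rewrite muln0 addn0.
apply: leq_trans tu; apply: leq_trans (leq_bigmax_seq _ vs _) => //=.
exact: leq_bigmax.
Qed.

End NormalForms.

(** * From periodicity to an affine stratification *)

Lemma stratification_of_periodic (d : nat) (J I : finType)
    (g : J -> 'cV[int]_d) (a : I -> 'cV[int]_d) (W : set 'cV[int]_d) (K c : nat) :
    0 < c ->
    (forall x, W x -> exists z, x = value g a z) ->
    (forall j (u : {ffun I -> nat}) i, K <= u i ->
       W (value g a (j, u)) <-> W (value g a (j, shift c u [:: i]))) ->
  has_affine_stratification W.
Proof.
move=> c0 gen per; have [t0 t0P] := normal_stable g a c.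
(* Beyond [t], both normality and membership in [W] are invariant under adding [c] to the
   coordinate. *)
pose t := maxn t0 K.
pose S j := [set u | normal g a (j, u) /\ W (value g a (j, u))].
have Sper j (u : {ffun I -> nat}) i : t <= u i -> S j u <-> S j (shift c u [:: i]).
  rewrite geq_max => /andP[u1 u2]; rewrite /S /=.
  by have := per j u i u2; have := t0P j u i u1; tauto.
(* One piece for each index [j] and corner [r] in [S j]; as a subtype of a finite type, [X] is
   finite. *)
pose X := {x : J * {ffun I -> 'I_(t + c)} | `[< S x.1 (corner x.2) >]}.
pose x (i : 'I_#|{: X}|) := val (enum_val i).
pose F i : set 'cV[int]_d := [set value g a ((x i).1, corner (x i).2)].
pose dirs i := [seq (a k *+ c)%R | k <- enum I & t <= (x i).2 k].
pose A i : set 'cV[int]_d := monoid_span [set` dirs i].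
have pieceP i y : minkowski_sum (F i) (A i) y <->
    exists s, all (fun k => t <= (x i).2 k) s /\
      y = value g a ((x i).1, shift c (corner (x i).2) s).
  split=> [[_ -> [_ [l lP ->] <-]]|[s [sP ->]]].
    have [s sP lE] : exists2 s, all (fun k => t <= (x i).2 k) s &
        l = [seq (a k *+ c)%R | k <- s].
      elim: l lP => [|b l IH] lP; first by exists [::].
      have [|s sP ->] := IH; first by move=> y' yl; apply: lP; rewrite inE yl orbT.
      have /mapP[k] : b \in dirs i by apply: lP; rewrite inE eqxx.
      by rewrite mem_filter => /andP[tk _] ->; exists (k :: s); rewrite //= tk.
    by exists s; split; rewrite // value_shift lE big_map.
  rewrite value_shift; exists (value g a ((x i).1, corner (x i).2)) => //.
  exists (\sum_(k <- s) a k *+ c)%R => //.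
  exists [seq (a k *+ c)%R | k <- s]; last by rewrite big_map.
  move=> _ /mapP[k ks ->]; apply/mapP; exists k => //.
  by rewrite mem_filter mem_enum (allP sP).
have xS i : S (x i).1 (corner (x i).2) by apply/asboolP; exact: (valP (enum_val i)).
have pieceS i s : all (fun k => t <= (x i).2 k) s ->
    S (x i).1 (shift c (corner (x i).2) s).
  move=> sP; apply: (shift_periodic (S := S (x i).1) (Sper _) _).1 (xS i).
  by apply: sub_all sP => k; rewrite ffunE.
exists #|{: X}|, F, A; split=> [i|i|].
- exact: finite_set1.
- by exists [set` dirs i]; [apply/finite_seqP; exists (dirs i)|].
split.
- apply/seteqP; split=> y.
    by case=> i _ /pieceP[s [sP ->]]; have [] := pieceS i s sP.
  move=> Wy; have [z yz] := gen y Wy.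
  have [[j u] nz zE] := normal_exists g a z.
  have [r [s [sP uE]]] := shift_corner_exists t c0 u.
  have Su : S j u by split=> //; rewrite zE -yz.
  have Sr : `[< S (j, r).1 (corner (j, r).2) >].
    apply/asboolP; apply: (shift_periodic (S := S j) (s := s) (Sper j) _).2; rewrite -?uE //=.
    by apply: sub_all sP => k; rewrite ffunE.
  exists (enum_rank (exist _ (j, r) Sr : X)) => //.
  by apply/pieceP; exists s; rewrite /x enum_rankK /= -uE; split=> //; rewrite zE.
(* Disjointness: a common element has only one normal representative, and that representative
   determines its corner. *)
- move=> i j _ _ [y [/pieceP[s [sP ->]] /pieceP[s' [sP' E]]]].
  have [n1 _] := pieceS i s sP; have [n2 _] := pieceS j s' sP'.
  have [] := normal_unique n1 n2 E => x1 /(shift_corner_inj c0 sP sP') x2.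
  apply: enum_val_inj; apply: val_inj.
  by move: x1 x2; rewrite /x; case: (val _) (val _) => [? ?] [? ?] /= -> ->.
(* A partition also requires nonempty pieces; the corner itself is a witness. *)
- move=> i _; exists (value g a ((x i).1, shift c (corner (x i).2) [::])).
  by apply/pieceP; exists [::].
Qed.

Local Open Scope ring_scope.

(** * Clearing denominators *)

Lemma common_denominator (s : seq rat) :
  exists2 D : nat, (0 < D)%N &
    forall x, x \in s -> exists z : int, D%:R * x = z%:~R.
Proof.
elim: s => [|x s [D D0 DP]]; first by exists 1%N.
exists (D * `|denq x|)%N; first by rewrite muln_gt0 D0 absz_gt0 denq_neq0.
have dx : `|denq x|%:R * x = (numq x)%:~R.
  rewrite pmulrn absz_denq -{2}(divq_num_den x) mulrC divfK //.
  by rewrite intr_eq0 denq_neq0.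
move=> y; rewrite inE => /orP[/eqP->|/DP[z yz]].
  by exists (D%:R * numq x); rewrite natrM -mulrA dx rmorphM /= natz.
exists (`|denq x|%:R * z); rewrite natrM mulrAC yz rmorphM /= mulrC.
by rewrite natz pmulrn.
Qed.

(** Multiplying all inequalities by one positive common denominator preserves their solutions. With
    integer data the slacks at lattice points are integers, so their absolute values can be fed to
    [dickson]. *)
Lemma integral_polyhedron (R : realType) (d : nat) (Pi : set 'cV[R]_d) :
    rational_polyhedron Pi ->
  exists (m : nat) (A : 'M[int]_(m, d)) (b : 'cV[int]_m),
    Pi = [set x | forall i, (map_mx intr A *m x) i 0 <= (b i 0)%:~R].
Proof.
case=> m [A [b ->]].
have [D D0 DP] := common_denominator
  ([seq A ij.1 ij.2 | ij : 'I_m * 'I_d] ++ [seq b i 0 | i : 'I_m]).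
have [A' A'P] : exists A' : 'I_m -> 'I_d -> int,
    forall i j, D%:R * A i j = (A' i j)%:~R.
  have /choice[A' A'P] (ij : 'I_m * 'I_d) :
      exists z : int, D%:R * A ij.1 ij.2 = z%:~R.
    by apply: DP; rewrite mem_cat; apply/orP; left; apply/mapP; exists ij;
      rewrite ?mem_enum.
  by exists (fun i j => A' (i, j)) => i j; exact: A'P (i, j).
have /choice[b' b'P] (i : 'I_m) : exists z : int, D%:R * b i 0 = z%:~R.
  by apply: DP; rewrite mem_cat; apply/orP; right; apply/mapP; exists i;
    rewrite ?mem_enum.
have intrR (z : int) : z%:~R = ratr z%:~R :> R by rewrite ratr_int.
exists m, (\matrix_(i, j) A' i j), (\col_i b' i).
apply: eq_set => x; apply: eq_forall => i.
have -> : (map_mx intr (\matrix_(i, j) A' i j) *m x) i 0 =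
    D%:R * (map_mx ratr A *m x) i 0.
  rewrite !mxE mulr_sumr; apply: eq_bigr => j _; rewrite !mxE intrR -A'P.
  by rewrite rmorphM /= ratr_nat mulrA.
by rewrite mxE intrR -b'P rmorphM /= ratr_nat ler_pM2l // ltr0n.
Qed.

Lemma npos_subz (x y : int) : x <= 0 -> y <= 0 -> (`|y| <= `|x|)%N ->
  x - y <= 0 /\ `|x|%N = (`|x - y| + `|y|)%N.
Proof. by lia. Qed.

Lemma subz_le0_of_gap (x y b : int) : x <= b -> y <= b ->
  (`|b - y| <= `|b - x|)%N -> x - y <= 0.
Proof. by lia. Qed.

(** * Integer points of a pointed polyhedron *)

Section FiniteGeneration.
Variables (m d : nat) (A : 'M[int]_(m, d)) (b : 'cV[int]_m).
Hypothesis A_inj : forall v : 'cV[int]_d, A *m v = 0 -> v = 0.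

Definition poly_points := [set p : 'cV[int]_d | forall i, (A *m p) i 0 <= b i 0].
Definition cone_points := [set v : 'cV[int]_d | forall i, (A *m v) i 0 <= 0].

(** Nonzero cone points are measured by the absolute values of the entries of [A *m v]. Subtracting
    a dominated [h] from [v] stays in the cone and lowers the sum of these values, strictly because
    [A_inj] gives [A *m h != 0]. *)
Lemma hilbert_basis : exists H : seq 'cV[int]_d,
  (forall h, h \in H -> cone_points h) /\
  forall v, cone_points v -> exists s : seq (seq_sub H), v = \sum_(h <- s) ssval h.
Proof.
have [H [HC HP]] := dickson
  [seq (fun v : 'cV[int]_d => `|((A *m v) i 0)%R|%N) | i <- enum 'I_m]
  (cone_points `&` [set v | v != 0]).
exists H; split=> [h /HC[]//|v].
have [n] := ubnP (\sum_i `|((A *m v) i 0)%R|)%N; elim: n v => // n IH v vn Cv.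
have [->|v0] := eqVneq v 0; first by exists [::]; rewrite big_nil.
have [h hH /Forall_map_enum hv] := HP v (conj Cv v0).
have [Ch /eqP h0] := HC h hH.
have AB i : (A *m (v - h)) i 0 = (A *m v) i 0 - (A *m h) i 0.
  by rewrite mulmxBr !mxE.
have [||s vE] := IH (v - h).
- suff: (\sum_i `|((A *m (v - h)) i 0)%R| < \sum_i `|((A *m v) i 0)%R|)%N.
    by move=> /leq_trans; apply.
  have -> : (\sum_i `|((A *m v) i 0)%R| =
      \sum_i `|((A *m (v - h)) i 0)%R| + \sum_i `|((A *m h) i 0)%R|)%N.
    rewrite -big_split; apply: eq_bigr => i _ /=; rewrite AB.
    exact: (npos_subz (Cv i) (Ch i) (hv i)).2.
  rewrite -[X in (X < _)%N]addn0 ltn_add2l lt0n; apply/eqP => sum0; apply/h0/A_inj.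
  apply/colP => i; rewrite [RHS]mxE; apply/eqP; rewrite -absz_eq0 -leqn0.
  by rewrite -[X in (_ <= X)%N]sum0 (bigD1 i) //= leq_addr.
- by move=> i; rewrite AB; exact: (npos_subz (Cv i) (Ch i) (hv i)).1.
by exists (SeqSub hH :: s); rewrite big_cons -vE /= addrC subrK.
Qed.

(** [G] comes from Dickson's lemma on the slack vectors [b - A *m p]: if the slack of [g] is at most
    that of [p], then [p - g] is a cone point. *)
Lemma poly_points_generated : exists G H : seq 'cV[int]_d,
  [/\ forall g, g \in G -> poly_points g,
      forall h, h \in H -> cone_points h &
      forall p, poly_points p -> exists (g : seq_sub G) (s : seq (seq_sub H)),
        p = ssval g + \sum_(h <- s) ssval h].
Proof.
have [H [HC HP]] := hilbert_basis.
have [G [GL GP]] := dickson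
  [seq (fun p : 'cV[int]_d => `|(b i 0 - (A *m p) i 0)%R|%N) | i <- enum 'I_m]
  poly_points.
exists G, H; split=> // p Lp.
have [g gG /Forall_map_enum gp] := GP p Lp.
have [|s sE] := HP (p - g).
  move=> i; rewrite mulmxBr [X in X <= _]mxE [X in _ + X <= _]mxE.
  exact: subz_le0_of_gap (Lp i) (GL g gG i) (gp i).
by exists (SeqSub gG), s; rewrite -sE /= addrC subrK.
Qed.

Lemma value_poly_points (J I : finType) (g : J -> 'cV[int]_d)
    (a : I -> 'cV[int]_d) z :
  (forall j, poly_points (g j)) -> (forall i, cone_points (a i)) ->
  poly_points (value g a z).
Proof.
move=> gL aC i; rewrite /value mulmxDr mxE -[leRHS]addr0 lerD ?gL //.
rewrite mulmx_sumr summxE; apply: sumr_le0 => k _.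
by rewrite raddfMn mulmxnE mulrn_wle0 ?aC.
Qed.

End FiniteGeneration.

(** * Finite misère quotients *)

Section Quotient.
Variables (R : realType) (d : nat) (Pi : set 'cV[R]_d) (W : set 'cV[int]_d).
Local Notation Lambda := (lattice_points Pi).
Local Notation M := (lattice_points (recession_cone Pi)).

(** Cancelling the translations turns the equality of sets into its pointwise form. *)
Lemma indistinguishable_shift p q r :
  indistinguishable Pi W p q -> M r -> W (p + r) <-> W (q + r).
Proof.
move=> E Mr; split=> Wr.
  have : (minkowski_sum [set p] M `&` W) (p + r).
    by split=> //; exists p => //; exists r.
  rewrite E => -[_ -> [_ [[_ -> [r' Mr' <-]] Wr'] /eqP]].
  by rewrite addrA subrK => /eqP /addrI <-.
have : minkowski_sum [set p - q] (minkowski_sum [set q] M `&` W) (p + r).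
  exists (p - q) => //; exists (q + r); last by rewrite addrA subrK.
  by split=> //; exists q => //; exists r.
by rewrite -E => -[].
Qed.

Lemma indistinguishable_refl p : indistinguishable Pi W p p.
Proof.
rewrite /indistinguishable subrr; apply/seteqP; split=> x.
  by move=> Hx; exists 0 => //; exists x; rewrite ?add0r.
by case=> _ -> [y Hy <-]; rewrite add0r.
Qed.

Lemma cone_mulrn a n : M a -> M (a *+ n).
Proof.
move=> Ma x Px t t0.
have -> : t *: embed R (a *+ n) = (t *+ n) *: embed R a.
  by rewrite /embed raddfMn -scalerMnr scalerMnl.
by apply: Ma => //; exact: mulrn_wge0.
Qed.

Lemma lattice_addr p a : Lambda p -> M a -> Lambda (p + a).
Proof.
by move=> Lp Ma; have := Ma _ Lp 1 ler01; rewrite scale1r /lattice_points /= /embed raddfD.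
Qed.

Lemma quotient_periodic : finite_set (misere_quotient Pi W) ->
  exists K c : nat, (0 < c)%N /\ forall p a n, Lambda p -> M a -> (K <= n)%N ->
    W (p + a *+ n) <-> W (p + a *+ (n + c)).
Proof.
move=> /finite_seqP[s sE].
(* Among the classes of [p + a *+ k] for [k <= size s] two coincide, say at [i < j]. The gap [j - i]
   depends on [p] and [a] but always divides the factorial, which serves as a uniform period. *)
exists (size s), (size s)`!; split=> [|p a n Lp Ma Kn]; first exact: fact_gt0.
have La k : Lambda (p + a *+ k) by apply: lattice_addr => //; exact: cone_mulrn.
pose cls k := [set q | Lambda q /\ indistinguishable Pi W (p + a *+ k) q].
have cls_s k : cls k \in s.
  suff : [set` s] (cls k) by [].
  by rewrite -sE; exists (p + a *+ k).
have /(uniqPn set0)[i [j [ij]]] : ~~ uniq (mkseq cls (size s).+1).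
  have sub : {subset mkseq cls (size s).+1 <= s} by move=> _ /mapP[k _ ->].
  by apply/negP => /uniq_leq_size /(_ sub); rewrite size_mkseq ltnn.
rewrite size_mkseq => js; rewrite !nth_mkseq ?(ltn_trans ij) // => clsE.
have ind : indistinguishable Pi W (p + a *+ i) (p + a *+ j).
  have : cls j (p + a *+ j) by split=> //; exact: indistinguishable_refl.
  by rewrite -clsE => -[].
(* Translating the indistinguishable pair by [a *+ (k - i)] makes [j - i] a period from [i] on,
   hence from [size s] on. *)
have step k : (size s <= k)%N -> W (p + a *+ k) <-> W (p + a *+ (k + (j - i))).
  move=> sk; have := indistinguishable_shift ind (@cone_mulrn a (k - i) Ma).
  rewrite -!addrA -!mulrnDr.
  have -> : (i + (k - i) = k)%N by lia.
  by have -> : (j + (k - i) = k + (j - i))%N by lia.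
have steps l : W (p + a *+ n) <-> W (p + a *+ (n + l * (j - i))).
  elim: l => [|l ->]; first by rewrite addn0.
  by rewrite step ?mulSnr ?addnA // (leq_trans Kn) ?leq_addr.
have /dvdnP[l ->] : (j - i %| (size s)`!)%N; last exact: steps.
by apply: dvdn_fact; lia.
Qed.

End Quotient.

(** * Periodicity of the P-positions along the generators of the polyhedron *)

Theorem theorem4p6 (R : realType) (d : nat) (Pi P : set 'cV[R]_d)
    (Pi_rational : rational_polyhedron Pi)
    (Pi_pointed : pointed Pi)
    (P_polytope : polytope P)
    (Pi_decomposition : Pi = minkowski_sum P (recession_cone Pi))
    (cone_full_dim : cone_dim (recession_cone Pi) d)
    (Gamma B W : set 'cV[int]_d)
    (game : lattice_game Pi Gamma B)
    (W_P_positions : P_positions Gamma B W)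
    (quotient_finite : finite_set (misere_quotient Pi W)) :
  has_affine_stratification W.
Proof.
(* The empty set is stratified with no pieces. Otherwise [p0] is a base point in [Pi]: a nonzero
   kernel vector of [A] would span a line through it, against pointedness. *)
have [[p0 Wp0]|W0] := pselect (W !=set0); last first.
  apply: (@stratification_of_periodic d 'I_0 'I_0 (fun=> 0) (fun=> 0) W 0 1) => //.
    by move=> x Wx; case: W0; exists x.
  by case.
have WL : W `<=` lattice_points Pi.
  case: game => _ [D [_ _ BE]]; case: W_P_positions => WB _ x /WB.
  by rewrite BE => -[].
have [m [A [b PiE]]] := integral_polyhedron Pi_rational.
have embedA p i : (map_mx intr A *m embed R p) i 0 = ((A *m p) i 0)%:~R.
  by rewrite /embed -map_mxM mxE.
have LE p : lattice_points Pi p <-> poly_points A b p.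
  rewrite /lattice_points /poly_points PiE /=.
  by split=> H i; have := H i; rewrite embedA ler_int.
have MC v : cone_points A v -> lattice_points (recession_cone Pi) v.
  move=> Cv x; rewrite PiE /= => xb t t0 i.
  rewrite mulmxDr -scalemxAr mxE [X in _ + X]mxE (embedA v) -[leRHS]addr0 lerD //.
  by rewrite mulr_ge0_le0 // lerz0.
have A_inj (v : 'cV[int]_d) : A *m v = 0 -> v = 0.
  move=> Av; apply: contrapT => /eqP v0; apply: Pi_pointed.
  exists (embed R p0), (embed R v); split.
    apply: contraNneq v0 => /matrixP v0; apply/eqP/matrixP => i j.
    by apply/eqP; have := v0 i j; rewrite !mxE => /eqP; rewrite intr_eq0.
  move=> t; have := WL _ Wp0; rewrite /lattice_points PiE /= => xb i.
  by rewrite mulmxDr -scalemxAr mxE [X in _ + X]mxE (embedA v) Av [X in X%:~R]mxE mulr0 addr0.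
have [G [H [GL HC gen]]] := poly_points_generated b A_inj.
have [K [c [c0 per]]] := quotient_periodic quotient_finite.
apply: (@stratification_of_periodic d (seq_sub G) (seq_sub H)
  (@ssval _ _) (@ssval _ _) W K c c0) => [x /WL/LE/gen[g [s ->]]|g u i Ku].
  (* Shifting the zero vector by [s] with step 1 records the multiplicities in [s]. *)
  exists (g, shift 1 [ffun=> 0%N] s); rewrite value_shift /value /=; congr (_ + _).
  by rewrite big1 ?addr0 // => h _; rewrite ffunE.
(* With coordinate [i] reset to zero, the value at [u] is the [u i]-th point on the ray from the
   value at [v] in direction [i], the form [per] expects. *)
pose v : {ffun seq_sub H -> nat} := [ffun k => if k == i then 0%N else u k].
have uE : u = shift (u i) v [:: i].
  apply/ffunP => k; rewrite !ffunE /= eq_sym.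
  by case: eqP => [->|_]; rewrite ?muln1 // muln0 addn0.
have vE : value (@ssval _ _) (@ssval _ _) (g, u) =
    value (@ssval _ _) (@ssval _ _) (g, v) + ssval i *+ u i.
  by rewrite {1}uE value_shift big_seq1.
rewrite value_shift vE big_seq1 -[X in _ <-> W X]addrA -mulrnDr.
apply: per => //; last by apply: MC; apply: HC; exact: ssvalP.
by apply/LE/value_poly_points => k; [apply/GL|apply/HC]; exact: ssvalP.
Qed.
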